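(* For $S\subseteq\omega$ let $S^{\mathscr I}=\{A : (\mathbb N,S)\vDash \mathrm T\ulcorner\mathrm T\ulcorner A\urcorner\urcorner\}$, and for a consistent fixed point $X$ of the Strong Kleene operator $\mathscr K$ let $\mathbb T_X=\{A\in\mathcal L_{\mathrm T}: A\text{ a sentence and }(\mathbb N,X)\vDash A\}$. Then for every $S\subseteq\omega$: $(\mathbb N,S)\vDash\mathsf{CKF}_{\mathsf{cs}}$ if and only if $S^{\mathscr I}$ is a consistent fixed point of $\mathscr K$ and $S=\mathbb T_{S^{\mathscr I}}$.
   Context: **Language and notation.** $\mathcal L_{\mathbb N}$ is the language of arithmetic over $\{\bar 0,\mathrm S,+,\times\}$ with finitely many additional function symbols for elementary syntactic operations: $\mathrm{num}$ (sending $n$ to the code of its numeral) and functions sending codes of expressions to the codes of their negation, conjunction, universal quantification, and the code of a term $t$ to the code of the atomic formula $\mathrm T(t)$, etc. $\mathbb N$ is its standard model. $\mathcal L_{\mathrm T}=\mathcal L_{\mathbb N}\cup\{\mathrm T\}$ with $\mathrm T$ a unary predicate; $(\mathbb N,S)$ interprets $\mathrm T$ by $S\subseteq\omega$. A Gödel numbering is fixed and expressions are identified with their codes. Logical primitives are $\neg,\wedge,\forall$, the others being defined. In axioms, $s,t$ range over codes of closed terms and $t^\circ$ is the value of $t$; $\varphi,\psi$ range over codes of sentences of $\mathcal L_{\mathrm T}$; $\varphi(v)$ ranges over codes of formulas with at most the variable $v$ free; $\varphi(t/v)$ is substitution. Connectives and predicates inside $\mathrm T$ denote the corresponding syntactic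 operations on codes. $\mathrm F x:=\mathrm T(\neg x)$ (with $\neg$ the syntactic negation function). $\mathrm T\mathrm T\varphi$ and $\mathrm T\mathrm F\varphi$ are $\mathrm T$ applied to the code of $\mathrm T(\mathrm{num}(\varphi))$, resp. of $\mathrm F(\mathrm{num}(\varphi))$. For $t$ a closed term code, $\mathrm T\mathrm T t$ and $\mathrm T\mathrm F t$ are $\mathrm T$ applied to the code of the sentence $\mathrm T(t)$, resp. $\mathrm F(t)$; and $\mathrm T\mathrm T\mathrm T t$, $\mathrm T\mathrm F\mathrm T t$ are $\mathrm T\mathrm T\varphi$, $\mathrm T\mathrm F\varphi$ for $\varphi$ the sentence $\mathrm T(t)$. **The theory $\mathsf{CKF}_{\mathsf{cs}}$** (classical closure of Kripke–Feferman truth with consistency) is the $\mathcal L_{\mathrm T}$-theory consisting of $\mathsf{PA}$ with induction for all $\mathcal L_{\mathrm T}$-formulas and: - (T1) $\forall s\forall t(\mathrm T(s=t)\leftrightarrow s^\circ=t^\circ)$ - (T4) $\forall\varphi(\mathrm T(\neg\varphi)\leftrightarrow\neg\mathrm T\varphi)$ - (T5) $\forall\varphi,\psi(\mathrm T(\varphi\wedge\psi)\leftrightarrow\mathrm T\varphi\wedge\mathrm T\psi)$ - (T6) $\forall\varphi(v)(\mathrm T(\forall v\varphi)\leftrightarrow\forall t\,\mathrm T\varphi(t/v))$ - (T7) $\forall s\forall t(\mathrm T\mathrm T(s=t)\leftrightarrow s^\circ=t^\circ)$ - (T8) $\forall s\forall t(\mathrm T\mathrm F(s=t)\leftrightarrow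 s^\circ\neq t^\circ)$ - (T9) $\forall\varphi(\mathrm T\mathrm T\varphi\leftrightarrow\mathrm T\mathrm T\neg\neg\varphi)$ - (T10) $\forall\varphi,\psi(\mathrm T\mathrm T(\varphi\wedge\psi)\leftrightarrow\mathrm T\mathrm T\varphi\wedge\mathrm T\mathrm T\psi)$ - (T11) $\forall\varphi,\psi(\mathrm T\mathrm F(\varphi\wedge\psi)\leftrightarrow\mathrm T\mathrm F\varphi\vee\mathrm T\mathrm F\psi)$ - (T12) $\forall\varphi(v)(\mathrm T\mathrm T(\forall v\varphi)\leftrightarrow\mathrm T(\forall t\,\mathrm T\varphi(t/v)))$ - (T13) $\forall\varphi(v)(\mathrm T\mathrm F(\forall v\varphi)\leftrightarrow\mathrm T(\exists t\,\mathrm F\varphi(t/v)))$ - (T14) $\forall t(\mathrm T\mathrm T\mathrm T t\leftrightarrow\mathrm T\mathrm T t)$ - (T15) $\forall t(\mathrm T\mathrm F\mathrm T t\leftrightarrow\mathrm T\mathrm F t)$ - (TDel) $\forall t(\mathrm T\mathrm T t\to\mathrm T t^\circ)$ - (R1) $\forall\varphi(v)\forall s\forall t(s^\circ=t^\circ\to(\mathrm T\varphi(s)\leftrightarrow\mathrm T\varphi(t)))$ In (T12), (T13), $\forall t\,\mathrm T\varphi(t/v)$ and $\exists t\,\mathrm F\varphi(t/v)$ under the outer $\mathrm T$ denote the code of the $\mathcal L_{\mathrm T}$-sentence saying ''for all closed terms $t$, $\mathrm T\varphi(t/v)$'', resp. ''for some closed term $t$, $\mathrm F\varphi(t/v)$''.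 **The operator $\mathscr K$.** For $X\subseteq\mathrm{Sent}_{\mathcal L_{\mathrm T}}$ (the set of codes of $\mathcal L_{\mathrm T}$-sentences), $n\in\mathscr K(X)$ iff $n\in\mathrm{Sent}_{\mathcal L_{\mathrm T}}$ and one of: $n$ is $s=t$ with $s^\circ=t^\circ$; $n$ is $s\neq t$ with $s^\circ\ne t^\circ$; $n$ is $\mathrm T t$ with $t^\circ\in X$; $n$ is $\neg\mathrm T t$ with $\neg t^\circ\in X$ or $t^\circ\in\omega\setminus\mathrm{Sent}_{\mathcal L_{\mathrm T}}$; $n$ is $\neg\neg\varphi$ with $\varphi\in X$; $n$ is $\varphi\wedge\psi$ with $\varphi\in X$ and $\psi\in X$; $n$ is $\neg(\varphi\wedge\psi)$ with $\neg\varphi\in X$ or $\neg\psi\in X$; $n$ is $\forall v\varphi$ with $\varphi(t/v)\in X$ for all closed terms $t$; $n$ is $\neg\forall v\varphi$ with $\neg\varphi(t/v)\in X$ for some closed term $t$. A fixed point is a set $X$ with $X=\mathscr K(X)$; it is consistent if there is no $\varphi$ with $\varphi\wedge\neg\varphi\in X$.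
   Formalization: Read literally the claim fails on non-sentences. Here S = T_{S^I} is required only on codes of sentences, and the syntactic negation function sends every non-sentence (open formulas included) to the code of ¬(0=1), so that (T15) agrees with the clause of K for ¬Tt. *)

(* Defs.v *)
From HB Require Import structures.
From mathcomp Require Import all_boot.

Set Implicit Arguments.
Unset Strict Implicit.
Unset Printing Implicit Defensive.

Inductive fun1 := FSucc | FNum | FNeg | FTr | FClTerm | FSent.
Inductive fun2 := FAdd | FMul | FEq | FAnd | FAll | FForm1.
Inductive fun3 := FSubst | FTab.

Definition syms1 := [:: FSucc; FNum; FNeg; FTr; FClTerm; FSent].
Definition syms2 := [:: FAdd; FMul; FEq; FAnd; FAll; FForm1].
Definition syms3 := [:: FSubst; FTab].

Inductive term :=
| Var of nat
| Zero
| App1 of fun1 & term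
| App2 of fun2 & term & term
| App3 of fun3 & term & term & term.

Inductive form :=
| Eq of term & term
| Tr of term
| Not of form
| And of form & form
| All of nat & form.

Definition Or A B := Not (And (Not A) (Not B)).
Definition Imp A B := Not (And A (Not B)).
Definition Iff A B := And (Imp A B) (Imp B A).
Definition Ex v A := Not (All v (Not A)).

Notation Succ := (App1 FSucc).

Fixpoint numeral (n : nat) : term :=
  if n is m.+1 then Succ (numeral m) else Zero.

Definition Falsum : form := Eq Zero (Succ Zero).
Definition Ors : seq form -> form := foldr Or Falsum.

Fixpoint fvt (t : term) : seq nat :=
  match t with
  | Var v => [:: v]
  | Zero => [::]
  | App1 _ a => fvt a
  | App2 _ a b => fvt a ++ fvt b
  | App3 _ a b c => fvt a ++ fvt b ++ fvt c
  end.

Fixpoint fv (A : form) : seq nat :=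
  match A with
  | Eq s t => fvt s ++ fvt t
  | Tr t => fvt t
  | Not B => fv B
  | And B C => fv B ++ fv C
  | All v B => [seq w <- fv B | w != v]
  end.

Definition closed_term (t : term) : bool := fvt t == [::].
Definition sentence (A : form) : bool := fv A == [::].
Definition form1 (v : nat) (A : form) : bool := all (pred1 v) (fv A).

(* Substitution of [t] for the free occurrences of [v].  Bound variables are
   not renamed: it is only used for [t] closed, or [t] equal to 0 or [Succ v],
   and then no capture can occur. *)
Fixpoint tsubst (v : nat) (t s : term) : term :=
  match s with
  | Var w => if w == v then t else s
  | Zero => Zero
  | App1 f a => App1 f (tsubst v t a)
  | App2 f a b => App2 f (tsubst v t a) (tsubst v t b)
  | App3 f a b c => App3 f (tsubst v t a) (tsubst v t b) (tsubst v t c)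
  end.

Fixpoint fsubst (v : nat) (t : term) (A : form) : form :=
  match A with
  | Eq r s => Eq (tsubst v t r) (tsubst v t s)
  | Tr s => Tr (tsubst v t s)
  | Not B => Not (fsubst v t B)
  | And B C => And (fsubst v t B) (fsubst v t C)
  | All w B => if w == v then A else All w (fsubst v t B)
  end.

Inductive expr := ETerm of term | EForm of form.

Section Coding.
Import GenTree.
Local Notation tree := (GenTree.tree nat).

Definition idx1 f :=
  match f with FSucc => 0 | FNum => 1 | FNeg => 2 | FTr => 3 | FClTerm => 4
             | FSent => 5 end.
Definition idx2 f :=
  match f with FAdd => 0 | FMul => 1 | FEq => 2 | FAnd => 3 | FAll => 4
             | FForm1 => 5 end.
Definition idx3 f := match f with FSubst => 0 | FTab => 1 end.

Fixpoint enc_term (t : term) : tree :=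
  match t with
  | Var v => Node 0 [:: Leaf v]
  | Zero => Node 1 [::]
  | App1 f a => Node 2 [:: Leaf (idx1 f); enc_term a]
  | App2 f a b => Node 3 [:: Leaf (idx2 f); enc_term a; enc_term b]
  | App3 f a b c =>
      Node 4 [:: Leaf (idx3 f); enc_term a; enc_term b; enc_term c]
  end.

Fixpoint enc_form (A : form) : tree :=
  match A with
  | Eq s t => Node 5 [:: enc_term s; enc_term t]
  | Tr t => Node 6 [:: enc_term t]
  | Not B => Node 7 [:: enc_form B]
  | And B C => Node 8 [:: enc_form B; enc_form C]
  | All v B => Node 9 [:: Leaf v; enc_form B]
  end.

Definition enc_expr (e : expr) : tree :=
  match e with ETerm t => enc_term t | EForm A => enc_form A end.

Fixpoint dec_term (x : tree) : option term :=
  match x with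
  | Node 0 [:: Leaf v] => Some (Var v)
  | Node 1 [::] => Some Zero
  | Node 2 [:: Leaf i; a] => omap (App1 (nth FSucc syms1 i)) (dec_term a)
  | Node 3 [:: Leaf i; a; b] =>
      if (dec_term a, dec_term b) is (Some s, Some t)
      then Some (App2 (nth FAdd syms2 i) s t) else None
  | Node 4 [:: Leaf i; a; b; c] =>
      if (dec_term a, dec_term b, dec_term c) is (Some r, Some s, Some t)
      then Some (App3 (nth FSubst syms3 i) r s t) else None
  | _ => None
  end.

Fixpoint dec_form (x : tree) : option form :=
  match x with
  | Node 5 [:: a; b] =>
      if (dec_term a, dec_term b) is (Some s, Some t)
      then Some (Eq s t) else None
  | Node 6 [:: a] => omap Tr (dec_term a)
  | Node 7 [:: a] => omap Not (dec_form a)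
  | Node 8 [:: a; b] =>
      if (dec_form a, dec_form b) is (Some A, Some B)
      then Some (And A B) else None
  | Node 9 [:: Leaf v; a] => omap (All v) (dec_form a)
  | _ => None
  end.

Definition dec_expr (x : tree) : option expr :=
  if dec_term x is Some t then Some (ETerm t) else omap EForm (dec_form x).

Lemma enc_termK : pcancel enc_term dec_term.
Proof.
elim=> [v||f a /= ->|f a /= -> b ->|f a /= -> b -> c ->] //=; by case: f.
Qed.

Lemma enc_formK : pcancel enc_form dec_form.
Proof.
elim=> [s t|t|A /= ->|A /= -> B ->|v A /= ->] //=; by rewrite !enc_termK.
Qed.

Lemma enc_exprK : pcancel enc_expr dec_expr.
Proof.
case=> [t|A]; rewrite /dec_expr /= ?enc_termK //.
have -> : dec_term (enc_form A) = None by case: A.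
by rewrite enc_formK.
Qed.

End Coding.

HB.instance Definition _ := Countable.copy expr (pcan_type enc_exprK).

(* Locked: unary codes must never be computed.  [pickle_inv], unlike
   [unpickle], is [None] on numbers that are not codes. *)
HB.lock Definition code_term (t : term) : nat := pickle (ETerm t).
HB.lock Definition code (A : form) : nat := pickle (EForm A).
HB.lock Definition decode (n : nat) : option expr := pickle_inv n.

Definition is_closed_term (n : nat) : bool :=
  if decode n is Some (ETerm t) then closed_term t else false.
Definition is_sentence (n : nat) : bool :=
  if decode n is Some (EForm A) then sentence A else false.
Definition is_form1 (v n : nat) : bool :=
  if decode n is Some (EForm A) then form1 v A else false.

Arguments is_closed_term : simpl never.
Arguments is_sentence : simpl never.
Arguments is_form1 : simpl never.

Definition term_of (n : nat) : term :=
  if decode n is Some (ETerm t) then t else Zero.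
Definition form_of (n : nat) : form :=
  if decode n is Some (EForm A) then A else Falsum.
Definition sent_of (n : nat) : form :=
  if is_sentence n then form_of n else Falsum.

(* Only sentences are ever negated by this symbol, except in F t for an
   arbitrary closed term t.  Off the codes of sentences its value is a
   convention: a non-sentence is negated as if it were the sentence 0 = 1.
   Since [kleene] makes "not T t" hold whenever t denotes a non-sentence, the
   axiom TFTt <-> TFt needs the negation of a non-sentence to be true. *)
Definition neg_code (n : nat) : nat := code (Not (sent_of n)).

Definition subst_code (e v t : nat) : nat :=
  match decode e with
  | Some (ETerm s) => code_term (tsubst v (term_of t) s)
  | Some (EForm A) => code (fsubst v (term_of t) A)
  | None => 0
  end.

(* c codes a finite sequence of pairs in which (u, w) occurs *)
Definition in_table (u w c : nat) : bool :=
  if (pickle_inv c : option (seq (nat * nat))) is Some s then (u, w) \in s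
  else false.

Arguments neg_code : simpl never.
Arguments subst_code : simpl never.
Arguments in_table : simpl never.

(* A variable is represented inside codes by its index. *)
Definition interp1 (f : fun1) (m : nat) : nat :=
  match f with
  | FSucc => m.+1
  | FNum => code_term (numeral m)
  | FNeg => neg_code m
  | FTr => code (Tr (term_of m))
  | FClTerm => is_closed_term m
  | FSent => is_sentence m
  end.

Definition interp2 (f : fun2) (m n : nat) : nat :=
  match f with
  | FAdd => m + n
  | FMul => m * n
  | FEq => code (Eq (term_of m) (term_of n))
  | FAnd => code (And (form_of m) (form_of n))
  | FAll => code (All m (form_of n))
  | FForm1 => is_form1 m n
  end.

Definition interp3 (f : fun3) (m n p : nat) : nat :=
  match f with
  | FSubst => subst_code m n p
  | FTab => in_table m n p
  end.

Fixpoint eval (e : nat -> nat) (t : term) : nat :=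
  match t with
  | Var v => e v
  | Zero => 0
  | App1 f a => interp1 f (eval e a)
  | App2 f a b => interp2 f (eval e a) (eval e b)
  | App3 f a b c => interp3 f (eval e a) (eval e b) (eval e c)
  end.

Definition value (t : term) : nat := eval (fun=> 0) t.

Definition upd (e : nat -> nat) (v n : nat) : nat -> nat :=
  fun w => if w == v then n else e w.

Fixpoint sat (S : nat -> Prop) (e : nat -> nat) (A : form) : Prop :=
  match A with
  | Eq s t => eval e s = eval e t
  | Tr t => S (eval e t)
  | Not B => ~ sat S e B
  | And B C => sat S e B /\ sat S e C
  | All v B => forall n, sat S (upd e v n) B
  end.

Definition models (S : nat -> Prop) (A : form) : Prop := forall e, sat S e A.

Definition models_theory (S : nat -> Prop) (Th : form -> Prop) : Prop :=
  forall A, Th A -> models S A.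

Definition quote_term (t : term) : term := numeral (code_term t).
Definition quote (A : form) : term := numeral (code A).

Definition Holds (t : term) : form := Eq t (Succ Zero).
Definition IsClTerm (t : term) : form := Holds (App1 FClTerm t).
Definition IsSent (t : term) : form := Holds (App1 FSent t).
Definition IsForm1 (v x : term) : form := Holds (App2 FForm1 v x).

Definition AllTerm v A := All v (Imp (IsClTerm (Var v)) A).
Definition ExTerm v A := Ex v (And (IsClTerm (Var v)) A).
Definition AllSent v A := All v (Imp (IsSent (Var v)) A).
(* for all variables v and all formulas x with at most v free *)
Definition AllForm1 v x A := All v (All x (Imp (IsForm1 (Var v) (Var x)) A)).

Notation dnum := (App1 FNum).
Notation dneg := (App1 FNeg).
Notation dT := (App1 FTr).
Notation deq := (App2 FEq).
Notation dand := (App2 FAnd).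
Notation dall := (App2 FAll).
Notation dsubst x v t := (App3 FSubst x v t).

(* The graph of the evaluation of closed terms.  Evaluation itself cannot be a
   function symbol of the language (diagonalize with [dsubst] and [dnum]); the
   graph says that some finite table of pairs (closed term, value) contains
   (x, y) and has each of its entries justified by other entries.  The bound
   variables are 20, ..., 28; [x] and [y] must not contain them. *)
Section Value.
Local Notation "# n" := (Var n) (at level 1).

Definition InTab (u w c : term) : form := Holds (App3 FTab u w c).
Definition Entry (u w : term) (A : form) : form :=
  And (IsClTerm u) (And (InTab u w #20) A).

Definition just1 (f : fun1) : form :=
  Ex 23 (Ex 24 (Entry #23 #24
    (And (Eq #21 (dsubst (quote_term (App1 f #0)) (numeral 0) #23))
         (Eq #22 (App1 f #24))))).

Definition just2 (f : fun2) : form :=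
  Ex 23 (Ex 24 (Ex 25 (Ex 26 (Entry #23 #24 (Entry #25 #26
    (And (Eq #21 (dsubst (dsubst (quote_term (App2 f #0 #1))
                            (numeral 0) #23) (numeral 1) #25))
         (Eq #22 (App2 f #24 #26)))))))).

Definition just3 (f : fun3) : form :=
  Ex 23 (Ex 24 (Ex 25 (Ex 26 (Ex 27 (Ex 28
    (Entry #23 #24 (Entry #25 #26 (Entry #27 #28
      (And (Eq #21 (dsubst (dsubst (dsubst (quote_term (App3 f #0 #1 #2))
                              (numeral 0) #23) (numeral 1) #25)
                              (numeral 2) #27))
           (Eq #22 (App3 f #24 #26 #28))))))))))).

Definition Justified : form :=
  Or (And (Eq #21 (quote_term Zero)) (Eq #22 Zero))
     (Or (Ors (map just1 syms1)) (Or (Ors (map just2 syms2))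
                                     (Ors (map just3 syms3)))).

Definition Val (x y : term) : form :=
  Ex 20 (And (InTab x y #20)
             (All 21 (All 22 (Imp (InTab #21 #22 #20) Justified)))).
End Value.

(* s° = t° and T t° for codes s, t of closed terms; as variable 10 is bound,
   [s] and [t] must not contain it. *)
Definition EqVal (s t : term) : form :=
  Ex 10 (And (Val s (Var 10)) (Val t (Var 10))).
Definition TrVal (t : term) : form := Ex 10 (And (Val t (Var 10)) (Tr (Var 10))).

Definition Fa (x : term) : form := Tr (dneg x).

(* For a code x of a closed term, the code of the sentence F(x) *)
Definition dF (x : term) : term :=
  dsubst (quote (Fa (Var 0))) (numeral 0) x.

(* TT and TF applied to a code of a closed term *)
Definition TTt (t : term) : form := Tr (dT t).
Definition TFt (t : term) : form := Tr (dF t).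
(* TT and TF applied to a code of a sentence *)
Definition TT (x : term) : form := TTt (dnum x).
Definition TF (x : term) : form := TFt (dnum x).

(* The sentences "for all closed terms t, T phi(t/v)" and "for some closed term
   t, F phi(t/v)", as functions of phi = Var 0 and v = Var 1, and their codes
   with the numerals of x and v put for these variables. *)
Definition all_true : form :=
  AllTerm 2 (Tr (dsubst (Var 0) (Var 1) (Var 2))).
Definition some_false : form :=
  ExTerm 2 (Fa (dsubst (Var 0) (Var 1) (Var 2))).
Definition inst2 (A : form) (x v : term) : term :=
  dsubst (dsubst (quote A) (numeral 0) (dnum x)) (numeral 1) (dnum v).

Section Theory.
Local Notation "# n" := (Var n) (at level 1).

(* Peano arithmetic with induction for the whole language.  The additional
   function symbols are axiomatized by the diagrams of their graphs. *)
Inductive PAT : form -> Prop :=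
| PA_succ0 : PAT (All 0 (Not (Eq (Succ #0) Zero)))
| PA_succI : PAT (All 0 (All 1 (Imp (Eq (Succ #0) (Succ #1)) (Eq #0 #1))))
| PA_add0 : PAT (All 0 (Eq (App2 FAdd #0 Zero) #0))
| PA_addS : PAT (All 0 (All 1
    (Eq (App2 FAdd #0 (Succ #1)) (Succ (App2 FAdd #0 #1)))))
| PA_mul0 : PAT (All 0 (Eq (App2 FMul #0 Zero) Zero))
| PA_mulS : PAT (All 0 (All 1
    (Eq (App2 FMul #0 (Succ #1)) (App2 FAdd (App2 FMul #0 #1) #0))))
| PA_def1 f m :
    PAT (Eq (App1 f (numeral m)) (numeral (interp1 f m)))
| PA_def2 f m n :
    PAT (Eq (App2 f (numeral m) (numeral n)) (numeral (interp2 f m n)))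
| PA_def3 f m n p :
    PAT (Eq (App3 f (numeral m) (numeral n) (numeral p))
            (numeral (interp3 f m n p)))
| PA_ind v A :
    PAT (Imp (And (fsubst v Zero A) (All v (Imp A (fsubst v (Succ #v) A))))
             (All v A)).

Inductive CKFcs : form -> Prop :=
| CKF_PAT A : PAT A -> CKFcs A
| CKF_T1 : CKFcs (AllTerm 0 (AllTerm 1
    (Iff (Tr (deq #0 #1)) (EqVal #0 #1))))
| CKF_T4 : CKFcs (AllSent 0 (Iff (Tr (dneg #0)) (Not (Tr #0))))
| CKF_T5 : CKFcs (AllSent 0 (AllSent 1
    (Iff (Tr (dand #0 #1)) (And (Tr #0) (Tr #1)))))
| CKF_T6 : CKFcs (AllForm1 1 0
    (Iff (Tr (dall #1 #0)) (AllTerm 2 (Tr (dsubst #0 #1 #2)))))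
| CKF_T7 : CKFcs (AllTerm 0 (AllTerm 1
    (Iff (TT (deq #0 #1)) (EqVal #0 #1))))
| CKF_T8 : CKFcs (AllTerm 0 (AllTerm 1
    (Iff (TF (deq #0 #1)) (Not (EqVal #0 #1)))))
| CKF_T9 : CKFcs (AllSent 0 (Iff (TT #0) (TT (dneg (dneg #0)))))
| CKF_T10 : CKFcs (AllSent 0 (AllSent 1
    (Iff (TT (dand #0 #1)) (And (TT #0) (TT #1)))))
| CKF_T11 : CKFcs (AllSent 0 (AllSent 1
    (Iff (TF (dand #0 #1)) (Or (TF #0) (TF #1)))))
| CKF_T12 : CKFcs (AllForm1 1 0
    (Iff (TT (dall #1 #0)) (Tr (inst2 all_true #0 #1))))
| CKF_T13 : CKFcs (AllForm1 1 0
    (Iff (TF (dall #1 #0)) (Tr (inst2 some_false #0 #1))))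
| CKF_T14 : CKFcs (AllTerm 0 (Iff (TT (dT #0)) (TTt #0)))
| CKF_T15 : CKFcs (AllTerm 0 (Iff (TF (dT #0)) (TFt #0)))
| CKF_TDel : CKFcs (AllTerm 0 (Imp (TTt #0) (TrVal #0)))
| CKF_R1 : CKFcs (AllForm1 1 0 (AllTerm 2 (AllTerm 3
    (Imp (EqVal #2 #3)
         (Iff (Tr (dsubst #0 #1 #2)) (Tr (dsubst #0 #1 #3))))))).
End Theory.

Definition Sent (n : nat) : Prop := is_sentence n.

Inductive kleene_clause (X : nat -> Prop) : form -> Prop :=
| K_eq s t : value s = value t -> kleene_clause X (Eq s t)
| K_neq s t : value s <> value t -> kleene_clause X (Not (Eq s t))
| K_T t : X (value t) -> kleene_clause X (Tr t)
| K_notT t A : value t = code A -> X (code (Not A)) ->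
    kleene_clause X (Not (Tr t))
| K_notT_nonsent t : ~ Sent (value t) -> kleene_clause X (Not (Tr t))
| K_notnot A : X (code A) -> kleene_clause X (Not (Not A))
| K_and A B : X (code A) -> X (code B) -> kleene_clause X (And A B)
| K_notand A B : X (code (Not A)) \/ X (code (Not B)) ->
    kleene_clause X (Not (And A B))
| K_all v A : (forall t, closed_term t -> X (code (fsubst v t A))) ->
    kleene_clause X (All v A)
| K_notall v A t : closed_term t -> X (code (Not (fsubst v t A))) ->
    kleene_clause X (Not (All v A)).

Definition kleene (X : nat -> Prop) (n : nat) : Prop :=
  exists A, [/\ n = code A, sentence A & kleene_clause X A].

Definition fixed_point (X : nat -> Prop) : Prop :=
  forall n, X n <-> kleene X n.

Definition consistent (X : nat -> Prop) : Prop :=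
  ~ exists A, X (code (And A (Not A))).

Definition consistent_fixed_point (X : nat -> Prop) : Prop :=
  fixed_point X /\ consistent X.

Definition internal (S : nat -> Prop) (n : nat) : Prop :=
  exists A, [/\ n = code A, sentence A & models S (Tr (quote (Tr (quote A))))].

Definition truth_set (X : nat -> Prop) (n : nat) : Prop :=
  exists A, [/\ n = code A, sentence A & models X A].

(* Main.v *)
Require Import Defs.
From mathcomp Require Import all_boot.
From Stdlib Require Import Classical_Prop.
From Stdlib Require List.

Set Implicit Arguments.
Unset Strict Implicit.
Unset Printing Implicit Defensive.

(** In the standard model every axiom says what it should: quantifiers over
    codes become quantifiers over closed terms, formulas and sentences, and the
    formula [Val], which speaks of finite tables, defines evaluation
    ([sat_Val]).  So a model of the theory is a set S that is compositional,
    satisfies the clauses for TT and TF, and disquotes: if T t is in S, so is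
    the value of t ([models_CKFcs]).

    Write X for the set of sentences A with TTA in S.

    If S is the set of sentences true in (N, X), then TTA and TFA belong to S
    iff X contains A, resp. the negation of A, and the sentence written under T
    in the clauses for quantifiers is evaluated in (N, X).  The clauses for TT
    and TF then say, shape by shape, that X contains a sentence iff X justifies
    it by a strong Kleene clause, that is, that X is a fixed point
    ([inner_clausesE], [fixed_pointE]).  Both directions use this equivalence,
    so that two facts remain.

    For a model S, S is the truth set of X: by compositionality it suffices to
    compare atomic sentences, and T t belongs to S iff the value of t belongs
    to X ([true_Tr_internal]).  Only a term t denoting a non-sentence needs an
    argument: then F t is in S, because non-sentences have the negation of
    Falsum for their negation; hence TFTt holds, and disquotation yields the
    negation of T t.  Consistency of X follows, since disquotation also makes X
    a subset of S.

    Conversely, the truth set of a consistent fixed point X is compositional,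
    and disquotation holds because X contains only sentences true in (N, X)
    ([fixed_point_true]).  There consistency serves for the negation of T t: if
    X contains the negation of the value of t, it does not contain that
    value. *)

(** * Codes *)

Lemma code_termK n t : n = code_term t -> decode n = Some (ETerm t).
Proof. by move=> ->; rewrite decode.unlock code_term.unlock pickleK_inv. Qed.

Lemma codeK n A : n = code A -> decode n = Some (EForm A).
Proof. by move=> ->; rewrite decode.unlock code.unlock pickleK_inv. Qed.

Lemma term_of_code t : term_of (code_term t) = t.
Proof. by rewrite /term_of (code_termK erefl). Qed.

Lemma form_of_code A : form_of (code A) = A.
Proof. by rewrite /form_of (codeK erefl). Qed.

Lemma code_term_inj : injective code_term.
Proof. exact: can_inj term_of_code. Qed.

Lemma code_inj : injective code.
Proof. exact: can_inj form_of_code. Qed.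

Lemma decodeK n :
  match decode n with
  | Some (ETerm t) => n = code_term t
  | Some (EForm A) => n = code A
  | None => True
  end.
Proof.
rewrite decode.unlock code_term.unlock code.unlock.
by have := @pickle_invK expr n; case: pickle_inv => [[t|A]|] //= ->.
Qed.

Lemma is_closed_term_code t : is_closed_term (code_term t) = closed_term t.
Proof. by rewrite /is_closed_term (code_termK erefl). Qed.

Lemma is_sentence_code A : is_sentence (code A) = sentence A.
Proof. by rewrite /is_sentence (codeK erefl). Qed.

Lemma is_form1_code v A : is_form1 v (code A) = form1 v A.
Proof. by rewrite /is_form1 (codeK erefl). Qed.

Lemma is_closed_termP n :
  is_closed_term n -> exists2 t, closed_term t & n = code_term t.
Proof.
rewrite /is_closed_term; have := decodeK n.
by case: decode => [[t|A]|] // -> ct; exists t.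
Qed.

Lemma SentP n : Sent n -> exists2 A, sentence A & n = code A.
Proof.
rewrite /Sent /is_sentence; have := decodeK n.
by case: decode => [[t|A]|] // -> sA; exists A.
Qed.

Lemma is_form1P v n : is_form1 v n -> exists2 A, form1 v A & n = code A.
Proof.
rewrite /is_form1; have := decodeK n.
by case: decode => [[t|A]|] // -> fA; exists A.
Qed.

Lemma neg_code_sentence A : sentence A -> neg_code (code A) = code (Not A).
Proof.
by rewrite /neg_code /sent_of is_sentence_code form_of_code => ->.
Qed.

Lemma neg_code_nonsentence n : ~ Sent n -> neg_code n = code (Not Falsum).
Proof. by rewrite /neg_code /sent_of /Sent => /negP/negbTE ->. Qed.

Lemma subst_code_term s v t :
  subst_code (code_term s) v (code_term t) = code_term (tsubst v t s).
Proof. by rewrite /subst_code (code_termK erefl) term_of_code. Qed.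

Lemma subst_code_form A v t :
  subst_code (code A) v (code_term t) = code (fsubst v t A).
Proof. by rewrite /subst_code (codeK erefl) term_of_code. Qed.

Definition codeE :=
  (term_of_code, form_of_code, is_closed_term_code, is_sentence_code,
   is_form1_code, subst_code_term, subst_code_form).

(** * Evaluation and substitution *)

Lemma eval_ext e e' t : {in fvt t, e =1 e'} -> eval e t = eval e' t.
Proof.
elim: t => [v|//|f a IHa|f a IHa b IHb|f a IHa b IHb c IHc] /= E.
- by apply: E; rewrite inE.
- by rewrite IHa.
- by rewrite IHa ?IHb // => x xs; apply: E; rewrite mem_cat xs ?orbT.
- by rewrite IHa ?IHb ?IHc // => x xs; apply: E; rewrite !mem_cat xs ?orbT.
Qed.

Lemma eval_closed e t : closed_term t -> eval e t = value t.
Proof. by move/eqP=> ct; apply: eval_ext => x; rewrite ct. Qed.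

Lemma eval_numeral e n : eval e (numeral n) = n.
Proof. by elim: n => //= n ->. Qed.

Lemma value_numeral n : value (numeral n) = n.
Proof. exact: eval_numeral. Qed.

Lemma closed_numeral n : closed_term (numeral n).
Proof. by rewrite /closed_term; elim: n. Qed.

Lemma eval_tsubst e v t s :
  eval e (tsubst v t s) = eval (upd e v (eval e t)) s.
Proof.
elim: s => [w|//|f a IHa|f a IHa b IHb|f a IHa b IHb c IHc] /=.
- by rewrite /upd; case: eqP.
- by rewrite IHa.
- by rewrite IHa IHb.
- by rewrite IHa IHb IHc.
Qed.

Lemma fvt_tsubst v t s :
  closed_term t -> fvt (tsubst v t s) = [seq w <- fvt s | w != v].
Proof.
move/eqP=> ct; elim: s => [w|//|f a IHa|f a IHa b IHb|f a IHa b IHb c IHc] /=.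
- by case: eqP => //=; rewrite ct.
- by rewrite IHa.
- by rewrite filter_cat IHa IHb.
- by rewrite !filter_cat IHa IHb IHc.
Qed.

Lemma tsubst_closed v t s : closed_term s -> tsubst v t s = s.
Proof.
rewrite /closed_term.
elim: s => [w|//|f a IHa|f a IHa b IHb|f a IHa b IHb c IHc] //=.
- by move/IHa->.
- by rewrite -!size_eq0 size_cat addn_eq0 !size_eq0 => /andP[/IHa-> /IHb->].
- by rewrite -!size_eq0 !size_cat !addn_eq0 !size_eq0
    => /and3P[/IHa-> /IHb-> /IHc->].
Qed.

Lemma fv_fsubst v t A :
  closed_term t -> fv (fsubst v t A) = [seq w <- fv A | w != v].
Proof.
move=> ct; elim: A => [r s|s|A IHA|A IHA B IHB|w A IHA] /=.
- by rewrite filter_cat !fvt_tsubst.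
- exact: fvt_tsubst.
- exact: IHA.
- by rewrite filter_cat IHA IHB.
- case: (eqVneq w v) => [->|_] /=; first by rewrite filter_id.
  by rewrite IHA -!filter_predI; apply: eq_filter => x /=; rewrite andbC.
Qed.

Lemma sentence_All v A : sentence (All v A) = form1 v A.
Proof.
by rewrite /sentence /form1 /= -size_eq0 size_filter -leqn0 leqNgt -has_count
  -all_predC; apply: eq_all => x /=; rewrite negbK.
Qed.

Lemma sentence_fsubst v t A :
  closed_term t -> sentence (fsubst v t A) = form1 v A.
Proof. by move=> ct; rewrite -sentence_All /sentence fv_fsubst. Qed.

Lemma sentence_Eq s t :
  sentence (Eq s t) = closed_term s && closed_term t.
Proof.
by rewrite /sentence /closed_term -!size_eq0 size_cat addn_eq0.
Qed.

Lemma sentence_And A B : sentence (And A B) = sentence A && sentence B.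
Proof. by rewrite /sentence -!size_eq0 size_cat addn_eq0. Qed.

(** * Satisfaction *)

Lemma sat_ext S e e' A :
  {in fv A, e =1 e'} -> (sat S e A <-> sat S e' A).
Proof.
elim: A e e' => [s t|t|A IHA|A IHA B IHB|v A IHA] e e' /= E.
- by rewrite (@eval_ext e e' s) ?(@eval_ext e e' t) // => x xs; apply: E;
    rewrite mem_cat xs ?orbT.
- by rewrite (eval_ext E).
- by rewrite (IHA e e').
- by rewrite (IHA e e') 1?(IHB e e') // => x xs; apply: E;
    rewrite mem_cat xs ?orbT.
- have EA n : {in fv A, upd e v n =1 upd e' v n}.
    move=> x xA; rewrite /upd; case: eqVneq => // xv.
    by apply: E; rewrite mem_filter xv.
  by split=> H n; have := H n; rewrite (IHA _ _ (EA n)).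
Qed.

Lemma sat_sentence S e e' A : sentence A -> (sat S e A <-> sat S e' A).
Proof. by move/eqP=> sA; apply: sat_ext => x; rewrite sA. Qed.

Lemma models_sentence S e A : sentence A -> (models S A <-> sat S e A).
Proof.
by move=> sA; split=> [|H e']; [apply | rewrite (sat_sentence S e' e)].
Qed.

(** The condition on [t] covers closed terms and the two terms of the induction
    scheme; it excludes capture, as a quantifier binding [v] stops the
    substitution. *)
Lemma sat_fsubst S e v t A : all (pred1 v) (fvt t) ->
  (sat S e (fsubst v t A) <-> sat S (upd e v (eval e t)) A).
Proof.
move=> tv; elim: A e => [r s|s|A IHA|A IHA B IHB|w A IHA] e /=.
- by rewrite !eval_tsubst.
- by rewrite eval_tsubst.
- by rewrite IHA.
- by rewrite IHA IHB.
case: eqVneq => [->|wv] /=.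
  by split=> H n; apply: (iffLR (sat_ext _ _) (H n)) => x _;
    rewrite /upd; case: eqP.
have Et n : eval (upd e w n) t = eval e t.
  apply: eval_ext => x /(allP tv)/= /eqP->.
  by rewrite /upd eq_sym (negbTE wv).
have En n : upd (upd e w n) v (eval e t) =1 upd (upd e v (eval e t)) w n.
  move=> x; rewrite /upd; case: (eqVneq x v) => // ->.
  by rewrite eq_sym (negbTE wv).
split=> H n; have := H n; rewrite IHA Et; apply: (iffLR (sat_ext _ _)) => x _;
  by rewrite En.
Qed.

Lemma sat_fsubst_closed S e v t A : closed_term t ->
  (sat S e (fsubst v t A) <-> sat S (upd e v (value t)) A).
Proof.
move=> ct; rewrite sat_fsubst ?eval_closed //; by move/eqP: ct => ->.
Qed.

(** Every number is the value of a closed term, its numeral. *)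
Lemma sat_All_closed S e v A :
  sat S e (All v A) <-> forall t, closed_term t -> sat S e (fsubst v t A).
Proof.
split=> [H t ct | H n]; first by rewrite sat_fsubst_closed.
by have := H _ (closed_numeral n);
  rewrite sat_fsubst_closed ?closed_numeral // value_numeral.
Qed.

(** The lemmas below are congruences, applied backwards along a formula to
    translate it under its quantifiers. *)
Section SatConnectives.
Variable S : nat -> Prop.
Implicit Types (e : nat -> nat) (P Q : Prop).

Lemma sat_not e A P : (sat S e A <-> P) -> (sat S e (Not A) <-> ~ P).
Proof. by move=> /= ->. Qed.

Lemma sat_and e A B P Q : (sat S e A <-> P) -> (sat S e B <-> Q) ->
  (sat S e (And A B) <-> P /\ Q).
Proof. by move=> /= -> ->. Qed.

Lemma sat_or e A B P Q : (sat S e A <-> P) -> (sat S e B <-> Q) ->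
  (sat S e (Or A B) <-> P \/ Q).
Proof. by move=> /= -> ->; have := classic P; have := classic Q; tauto. Qed.

Lemma sat_imp e A B P Q : (sat S e A <-> P) -> (sat S e B <-> Q) ->
  (sat S e (Imp A B) <-> (P -> Q)).
Proof. by move=> /= -> ->; have := classic Q; tauto. Qed.

Lemma sat_iff e A B P Q : (sat S e A <-> P) -> (sat S e B <-> Q) ->
  (sat S e (Iff A B) <-> (P <-> Q)).
Proof.
by move=> EA EB; apply: sat_and (sat_imp EA EB) (sat_imp EB EA).
Qed.

Lemma sat_ex e v A (P : nat -> Prop) :
    (forall n, sat S (upd e v n) A <-> P n) ->
  (sat S e (Ex v A) <-> exists n, P n).
Proof.
move=> EA /=; split=> [H | [n Pn] H]; last exact: H n (iffRL (EA n) Pn).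
by apply: NNPP => nP; apply: H => n /EA Pn; apply: nP; exists n.
Qed.

Lemma eq_nat_of_bool (b : bool) : (nat_of_bool b = 1) <-> b.
Proof. by case: b. Qed.

Lemma sat_all e v A (P : nat -> Prop) :
    (forall n, sat S (upd e v n) A <-> P n) ->
  (sat S e (All v A) <-> forall n, P n).
Proof. by move=> EA; split=> H n; apply/EA. Qed.

Lemma sat_all_term e v A (P : term -> Prop) :
    (forall t, closed_term t -> (sat S (upd e v (code_term t)) A <-> P t)) ->
  (sat S e (AllTerm v A) <-> forall t, closed_term t -> P t).
Proof.
move=> EA; rewrite (sat_all (fun n => sat_imp (iff_refl _) (iff_refl _))) /=.
rewrite /upd eqxx -/upd.
split=> [H t ct | H n]; first by apply/EA/H; rewrite // codeE ct.
rewrite eq_nat_of_bool => /is_closed_termP[t ct ->].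
by apply/EA => //; apply: H.
Qed.

Lemma sat_ex_term e v A (P : term -> Prop) :
    (forall t, closed_term t -> (sat S (upd e v (code_term t)) A <-> P t)) ->
  (sat S e (ExTerm v A) <-> exists2 t, closed_term t & P t).
Proof.
move=> EA.
rewrite (sat_ex (fun n => sat_and (iff_refl _) (iff_refl _))) /=.
rewrite /upd eqxx -/upd; split=> [[n]|[t ct Pt]].
  rewrite eq_nat_of_bool => -[/is_closed_termP[t ct ->]] /EA Pt.
  by exists t => //; apply: Pt.
by exists (code_term t); rewrite codeE ct; split=> //; apply/EA.
Qed.

Lemma sat_all_sent e v A (P : form -> Prop) :
    (forall B, sentence B -> (sat S (upd e v (code B)) A <-> P B)) ->
  (sat S e (AllSent v A) <-> forall B, sentence B -> P B).
Proof.
move=> EA; rewrite (sat_all (fun n => sat_imp (iff_refl _) (iff_refl _))) /=.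
rewrite /upd eqxx -/upd.
split=> [H B sB | H n]; first by apply/EA/H; rewrite // codeE sB.
by rewrite eq_nat_of_bool => /SentP[B sB ->]; apply/EA => //; apply: H.
Qed.

Lemma sat_all_form1 e v x A (P : nat -> form -> Prop) : v != x ->
    (forall w B, form1 w B ->
      (sat S (upd (upd e v w) x (code B)) A <-> P w B)) ->
  (sat S e (AllForm1 v x A) <-> forall w B, form1 w B -> P w B).
Proof.
move=> vx EA; rewrite (sat_all (fun w => sat_all (fun n =>
  sat_imp (iff_refl _) (iff_refl _)))) /=.
rewrite /upd !eqxx (negbTE vx) -/upd.
split=> [H w B fB | H w n]; first by apply/EA/H; rewrite // codeE fB.
by rewrite eq_nat_of_bool => /is_form1P[B fB ->]; apply/EA => //; apply: H.
Qed.

End SatConnectives.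

(** * Evaluation of closed terms defined by finite tables *)

Lemma eval_quote_term e t : eval e (quote_term t) = code_term t.
Proof. exact: eval_numeral. Qed.

Lemma eval_quote e A : eval e (quote A) = code A.
Proof. exact: eval_numeral. Qed.

(** The meaning of [Justified]: the value of a term in the table comes from
    values that the table gives to its immediate subterms. *)
Inductive justified (tab : nat -> nat -> Prop) : term -> nat -> Prop :=
| justified0 : justified tab Zero 0
| justified1 f a m : closed_term a -> tab (code_term a) m ->
    justified tab (App1 f a) (interp1 f m)
| justified2 f a b m n : closed_term a -> closed_term b ->
    tab (code_term a) m -> tab (code_term b) n ->
    justified tab (App2 f a b) (interp2 f m n)
| justified3 f a b c m n p :
    closed_term a -> closed_term b -> closed_term c ->
    tab (code_term a) m -> tab (code_term b) n -> tab (code_term c) p ->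
    justified tab (App3 f a b c) (interp3 f m n p).

Lemma sat_Ors S e T (g : T -> form) (l : seq T) :
  sat S e (Ors (map g l)) <-> exists2 x, List.In x l & sat S e (g x).
Proof.
elim: l => [|y l IHl]; first by split=> //= -[].
rewrite (sat_or (iff_refl _) IHl); split=> [[gy|[x xl gx]]|[x [<-|xl] gx]].
- by exists y; first by left.
- by exists x; first by right.
- by left.
- by right; exists x.
Qed.

Section JustifiedFormulas.
Variables (S : nat -> Prop) (e : nat -> nat).
Let tab u w : Prop := in_table u w (e 20).

Lemma sat_just1 f : sat S e (just1 f) <->
  exists a m, [/\ closed_term a, tab (code_term a) m,
    e 21 = code_term (App1 f a) & e 22 = interp1 f m].
Proof.
rewrite (sat_ex (fun n => sat_ex (fun m => iff_refl _))).
rewrite /=; setoid_rewrite eval_quote_term; rewrite /upd /= /tab.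
split=> [[n [m]]|[a [m [ca]]]].
  rewrite !eq_nat_of_bool => -[/is_closed_termP[a ca ->]] [am].
  by rewrite codeE => -[]; exists a, m.
by exists (code_term a), m; rewrite !eq_nat_of_bool !codeE.
Qed.

Lemma sat_just2 f : sat S e (just2 f) <->
  exists a m b n, [/\ closed_term a /\ tab (code_term a) m,
    closed_term b /\ tab (code_term b) n,
    e 21 = code_term (App2 f a b) & e 22 = interp2 f m n].
Proof.
rewrite (sat_ex (fun i => sat_ex (fun m => sat_ex (fun j => sat_ex (fun n =>
  iff_refl _))))).
rewrite /=; setoid_rewrite eval_quote_term; rewrite /upd /= /tab.
split=> [[i [m [j [n]]]]|[a [m [b [n [[ca am] [cb bn]]]]]]].
  rewrite !eq_nat_of_bool => -[/is_closed_termP[a ca ->]] [am].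
  case=> /is_closed_termP[b cb ->] [bn].
  by rewrite !codeE /= tsubst_closed // => -[]; exists a, m, b, n.
exists (code_term a), m, (code_term b), n.
by rewrite !eq_nat_of_bool !codeE /= tsubst_closed.
Qed.

Lemma sat_just3 f : sat S e (just3 f) <->
  exists a m b n c p, [/\ closed_term a /\ tab (code_term a) m,
    closed_term b /\ tab (code_term b) n,
    closed_term c /\ tab (code_term c) p,
    e 21 = code_term (App3 f a b c) & e 22 = interp3 f m n p].
Proof.
rewrite (sat_ex (fun i => sat_ex (fun m => sat_ex (fun j => sat_ex (fun n =>
  sat_ex (fun k => sat_ex (fun p => iff_refl _))))))).
rewrite /=; setoid_rewrite eval_quote_term; rewrite /upd /= /tab.
split=> [[i [m [j [n [k [p]]]]]]
        |[a [m [b [n [c [p [[ca am] [cb bn] [cc cp]]]]]]]]].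
  rewrite !eq_nat_of_bool => -[/is_closed_termP[a ca ->]] [am].
  case=> /is_closed_termP[b cb ->] [bn].
  case=> /is_closed_termP[c cc ->] [cp].
  rewrite !codeE /= !(tsubst_closed _ _ ca) (tsubst_closed _ _ cb) => -[].
  by exists a, m, b, n, c, p.
exists (code_term a), m, (code_term b), n, (code_term c), p.
rewrite !eq_nat_of_bool !codeE /=.
by rewrite !(tsubst_closed _ _ ca) (tsubst_closed _ _ cb).
Qed.

Lemma sat_Justified : sat S e Justified <->
  exists2 t, e 21 = code_term t & justified tab t (e 22).
Proof.
rewrite (sat_or (iff_refl _) (sat_or (sat_Ors _ _ _ _)
  (sat_or (sat_Ors _ _ _ _) (sat_Ors _ _ _ _)))) /= eval_quote_term.
split=> [[[e21 ->]|[[f _ /sat_just1]|[[f _ /sat_just2]|[f _ /sat_just3]]]]|].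
- by exists Zero; last exact: justified0.
- by case=> a [m [ca am e21 ->]]; exists (App1 f a) => //; apply: justified1.
- case=> a [m [b [n [[ca am] [cb bn] e21 ->]]]]; exists (App2 f a b) => //.
  exact: justified2.
- case=> a [m [b [n [c [p [[ca am] [cb bn] [cc cp] e21 ->]]]]]].
  by exists (App3 f a b c) => //; apply: justified3.
case=> t e21 Jt; move Em: (e 22) Jt => m Jt.
case: Jt e21 Em => [|f a k ca am|f a b k n ca cb am bn
                    |f a b c k n p ca cb cc am bn cp] e21 e22.
- by left.
- right; left; exists f; first by case: f e21 e22; tauto.
  by apply/sat_just1; exists a, k.
- right; right; left; exists f; first by case: f e21 e22; tauto.
  by apply/sat_just2; exists a, k, b, n.
- right; right; right; exists f; first by case: f e21 e22; tauto.
  by apply/sat_just3; exists a, k, b, n, c, p.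
Qed.

End JustifiedFormulas.

(** Soundness of tables, by induction on the term: a justified entry has the
    only value allowed by the entries for the subterms. *)
Lemma justified_value (tab : nat -> nat -> Prop) :
    (forall u w, tab u w -> exists2 t, u = code_term t & justified tab t w) ->
  forall t m, tab (code_term t) m -> m = value t.
Proof.
move=> J; elim=> [v||f a IHa|f a IHa b IHb|f a IHa b IHb c IHc] m /J[t'];
  move/code_term_inj <- => Jt; inversion Jt => //=.
- by congr interp1; apply: IHa.
- by congr interp2; [apply: IHa | apply: IHb].
- by congr interp3; [apply: IHa | apply: IHb | apply: IHc].
Qed.

(** The subterms of a term with their values form the table that witnesses
    [Val]. *)
Fixpoint value_table (t : term) : seq (nat * nat) :=
  (code_term t, value t) ::
  match t with
  | App1 _ a => value_table a
  | App2 _ a b => value_table a ++ value_table b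
  | App3 _ a b c => value_table a ++ value_table b ++ value_table c
  | _ => [::]
  end.

Lemma mem_value_table t : (code_term t, value t) \in value_table t.
Proof. by case: t => *; rewrite inE eqxx. Qed.

(** The superset [s] lets the induction pass from the table of a subterm to the
    whole table. *)
Lemma value_table_justified t (s : seq (nat * nat)) :
    closed_term t -> {subset value_table t <= s} ->
  forall u w, (u, w) \in value_table t ->
    exists2 r, u = code_term r & justified (fun i j => (i, j) \in s) r w.
Proof.
rewrite /closed_term.
elim: t => [v|//|f a IHa|f a IHa b IHb|f a IHa b IHb c IHc] //.
- move=> _ _ u w; rewrite inE => /eqP[-> ->]; exists Zero => //.
  exact: justified0.
- move=> /= ca sub u w; rewrite inE => /predU1P[[-> ->]|].
    exists (App1 f a) => //; apply: justified1 => //.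
    by apply: sub; rewrite inE mem_value_table orbT.
  by apply: IHa => // x xa; apply: sub; rewrite inE xa orbT.
- move=> /=; rewrite -size_eq0 size_cat addn_eq0 !size_eq0 => /andP[ca cb] sub.
  have sa : {subset value_table a <= s}.
    by move=> x xa; apply: sub; rewrite inE mem_cat xa !orbT.
  have sb : {subset value_table b <= s}.
    by move=> x xa; apply: sub; rewrite inE mem_cat xa !orbT.
  move=> u w; rewrite inE mem_cat => /predU1P[[-> ->]|/orP[]].
  + exists (App2 f a b) => //; apply: justified2 => //.
    * exact/sa/mem_value_table.
    * exact/sb/mem_value_table.
  + exact: IHa.
  + exact: IHb.
- move=> /=; rewrite -size_eq0 !size_cat !addn_eq0 !size_eq0.
  case/and3P=> ca cb cc sub.
  have sa : {subset value_table a <= s}.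
    by move=> x xa; apply: sub; rewrite inE !mem_cat xa !orbT.
  have sb : {subset value_table b <= s}.
    by move=> x xa; apply: sub; rewrite inE !mem_cat xa !orbT.
  have sc : {subset value_table c <= s}.
    by move=> x xa; apply: sub; rewrite inE !mem_cat xa !orbT.
  move=> u w; rewrite inE !mem_cat => /predU1P[[-> ->]|/or3P[]].
  + exists (App3 f a b c) => //; apply: justified3 => //.
    * exact/sa/mem_value_table.
    * exact/sb/mem_value_table.
    * exact/sc/mem_value_table.
  + exact: IHa.
  + exact: IHb.
  + exact: IHc.
Qed.

Lemma in_table_pickle u w (s : seq (nat * nat)) :
  in_table u w (pickle s) = ((u, w) \in s).
Proof. by rewrite /in_table pickleK_inv. Qed.

(** The bounds on [i] and [j] keep the two variables apart from those bound in
    [Val]. *)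
Lemma sat_Val S e i j t : i < 20 -> j < 20 -> closed_term t ->
  e i = code_term t -> (sat S e (Val (Var i) (Var j)) <-> e j = value t).
Proof.
move=> i20 j20 ct ei; rewrite (sat_ex (fun c => sat_and (iff_refl _)
  (sat_all (fun u => sat_all (fun w => sat_imp (iff_refl _)
    (sat_Justified _ _)))))).
rewrite /= /upd /= !ltn_eqF // ei; split=> [[c []]|->].
  rewrite eq_nat_of_bool => tc J; apply: (justified_value _ tc) => u w uw.
  by apply: J; rewrite eq_nat_of_bool.
exists (pickle (value_table t)).
rewrite eq_nat_of_bool in_table_pickle mem_value_table; split=> // u w.
rewrite eq_nat_of_bool in_table_pickle => uw.
have [r -> Jr] := value_table_justified ct (fun=> id) uw; exists r => //.
by case: Jr => *; constructor; rewrite ?in_table_pickle.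
Qed.

Lemma sat_EqVal S e i j s t : i < 10 -> j < 10 ->
    closed_term s -> closed_term t -> e i = code_term s -> e j = code_term t ->
  (sat S e (EqVal (Var i) (Var j)) <-> value s = value t).
Proof.
move=> i10 j10 cs ct ei ej.
have lt20 k : k < 10 -> k < 20 by move/leq_trans; apply.
have Ee k n : k < 10 -> upd e 10 n k = e k by move=> ?; rewrite /upd ltn_eqF.
rewrite (sat_ex (fun n => sat_and
  (sat_Val (t := s) (j := 10) S (lt20 _ i10) isT cs (etrans (Ee _ n i10) ei))
  (sat_Val (t := t) (j := 10) S (lt20 _ j10) isT ct (etrans (Ee _ n j10) ej)))).
by rewrite /upd eqxx; split=> [[n [<- <-]]|]; last by exists (value s).
Qed.

Lemma sat_TrVal S e i t : i < 10 -> closed_term t -> e i = code_term t ->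
  (sat S e (TrVal (Var i)) <-> S (value t)).
Proof.
move=> i10 ct ei.
have i20 : i < 20 by apply: leq_trans i10 _.
have Ee n : upd e 10 n i = e i by rewrite /upd ltn_eqF.
rewrite (sat_ex (fun n => sat_and
  (sat_Val (t := t) (j := 10) S i20 isT ct (etrans (Ee n) ei)) (iff_refl _))).
by rewrite /= /upd eqxx; split=> [[n [<-]]|]; last by exists (value t).
Qed.

(** * The axioms read in the standard model *)

(** The meaning of [CKF_T1], [CKF_T4], [CKF_T5], [CKF_T6] and [CKF_R1]. *)
Record compositional (S : nat -> Prop) : Prop := Compositional {
  true_eq : forall s, closed_term s -> forall t, closed_term t ->
    (S (code (Eq s t)) <-> value s = value t);
  true_not : forall A, sentence A -> (S (code (Not A)) <-> ~ S (code A));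
  true_and : forall A, sentence A -> forall B, sentence B ->
    (S (code (And A B)) <-> S (code A) /\ S (code B));
  true_all : forall v A, form1 v A ->
    (S (code (All v A)) <->
     forall t, closed_term t -> S (code (fsubst v t A)));
  true_subst : forall v A, form1 v A ->
    forall s, closed_term s -> forall t, closed_term t -> value s = value t ->
    (S (code (fsubst v s A)) <-> S (code (fsubst v t A)))
}.

(** The formula whose code is denoted by [inst2 A x v] when [x] and [v] have the
    values [n] and [v]. *)
Definition inst_numerals (A : form) (n v : nat) : form :=
  fsubst 1 (numeral v) (fsubst 0 (numeral n) A).

(** The meaning of the axioms from [CKF_T7] to [CKF_T15].  [Fa (quote A)]
    applies the negation symbol to a numeral: it differs from
    [Tr (quote (Not A))], and [CKF_R1] makes the two equivalent under T
    ([true_Fa_quote]). *)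
Record inner_clauses (S : nat -> Prop) : Prop := InnerClauses {
  inner_eq : forall s, closed_term s -> forall t, closed_term t ->
    (S (code (Tr (quote (Eq s t)))) <-> value s = value t);
  inner_neq : forall s, closed_term s -> forall t, closed_term t ->
    (S (code (Fa (quote (Eq s t)))) <-> value s <> value t);
  inner_notnot : forall A, sentence A ->
    (S (code (Tr (quote A))) <-> S (code (Tr (quote (Not (Not A))))));
  inner_and : forall A, sentence A -> forall B, sentence B ->
    (S (code (Tr (quote (And A B)))) <->
     S (code (Tr (quote A))) /\ S (code (Tr (quote B))));
  inner_notand : forall A, sentence A -> forall B, sentence B ->
    (S (code (Fa (quote (And A B)))) <->
     S (code (Fa (quote A))) \/ S (code (Fa (quote B))));
  inner_all : forall v A, form1 v A ->
    (S (code (Tr (quote (All v A)))) <->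
     S (code (inst_numerals all_true (code A) v)));
  inner_notall : forall v A, form1 v A ->
    (S (code (Fa (quote (All v A)))) <->
     S (code (inst_numerals some_false (code A) v)));
  inner_T : forall t, closed_term t ->
    (S (code (Tr (quote (Tr t)))) <-> S (code (Tr t)));
  inner_F : forall t, closed_term t ->
    (S (code (Fa (quote (Tr t)))) <-> S (code (Fa t)))
}.

(** The meaning of [CKF_TDel]. *)
Definition disquoting (S : nat -> Prop) : Prop :=
  forall t, closed_term t -> S (code (Tr t)) -> S (value t).

Lemma PAT_sound S A : PAT A -> models S A.
Proof.
case=> [||||||f m|f m n|f m n p|v B] e.
- by move=> n; rewrite /upd /=.
- apply/(sat_all (fun m => sat_all (fun n =>
    sat_imp (iff_refl _) (iff_refl _)))).
  by move=> m n /= [].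
- by move=> n; rewrite /= addn0.
- by move=> m n; rewrite /= addnS.
- by move=> n; rewrite /= muln0.
- by move=> m n; rewrite /= mulnSr.
- by rewrite /= !eval_numeral.
- by rewrite /= !eval_numeral.
- by rewrite /= !eval_numeral.
have v0 : all (pred1 v) (fvt Zero) by [].
have vS : all (pred1 v) (fvt (Succ (Var v))) by rewrite /= eqxx.
rewrite (sat_imp (sat_and (sat_fsubst _ _ _ v0) (sat_all (fun n =>
  sat_imp (iff_refl _) (sat_fsubst _ _ _ vS)))) (iff_refl _)).
case=> B0 BS n; elim: n => [//|n /BS].
apply: (iffLR (sat_ext _ _)) => x _.
by rewrite /= /upd eqxx; case: eqP.
Qed.

(** [sat_axiom] proves that an axiom is satisfied iff its reading holds: it
    follows the formula, then computes the codes denoted by the terms. *)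
Ltac sat_leaf := rewrite /= ?eval_quote /upd /= ?eval_quote ?codeE
  ?neg_code_sentence ?codeE //.

Ltac sat_axiom :=
  lazymatch goal with
  | |- sat _ _ (AllTerm _ _) <-> _ =>
      apply: sat_all_term => ? ?; sat_axiom
  | |- sat _ _ (AllSent _ _) <-> _ =>
      apply: sat_all_sent => ? ?; sat_axiom
  | |- sat _ _ (AllForm1 _ _ _) <-> _ =>
      apply: sat_all_form1 => [//|? ? ?]; sat_axiom
  | |- sat _ _ (Iff _ _) <-> _ => apply: sat_iff; sat_axiom
  | |- sat _ _ (Imp _ _) <-> _ => apply: sat_imp; sat_axiom
  | |- sat _ _ (Or _ _) <-> _ => apply: sat_or; sat_axiom
  | |- sat _ _ (And _ _) <-> _ => apply: sat_and; sat_axiom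
  | |- sat _ _ (Not _) <-> _ => apply: sat_not; sat_axiom
  | |- sat _ _ (EqVal _ _) <-> _ => exact: sat_EqVal
  | |- sat _ _ (TrVal _) <-> _ => exact: sat_TrVal
  | |- _ => sat_leaf
  end.

Lemma models_CKFcs S : models_theory S CKFcs <->
  [/\ compositional S, inner_clauses S & disquoting S].
Proof.
split=> [H | [C I D] _ [A PA|||||||||||||||] ].
- split; first split; last 1 first.
  + apply: (iffLR _ (H _ CKF_TDel (fun=> 0))); sat_axiom.
  + apply: (iffLR _ (H _ CKF_T1 (fun=> 0))); sat_axiom.
  + apply: (iffLR _ (H _ CKF_T4 (fun=> 0))); sat_axiom.
  + apply: (iffLR _ (H _ CKF_T5 (fun=> 0))); sat_axiom.
  + apply: (iffLR _ (H _ CKF_T6 (fun=> 0))); sat_axiom.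
  + apply: (iffLR _ (H _ CKF_R1 (fun=> 0))); sat_axiom.
  split.
  + apply: (iffLR _ (H _ CKF_T7 (fun=> 0))); sat_axiom.
  + apply: (iffLR _ (H _ CKF_T8 (fun=> 0))); sat_axiom.
  + apply: (iffLR _ (H _ CKF_T9 (fun=> 0))); sat_axiom.
  + apply: (iffLR _ (H _ CKF_T10 (fun=> 0))); sat_axiom.
  + apply: (iffLR _ (H _ CKF_T11 (fun=> 0))); sat_axiom.
  + apply: (iffLR _ (H _ CKF_T12 (fun=> 0))); sat_axiom.
  + apply: (iffLR _ (H _ CKF_T13 (fun=> 0))); sat_axiom.
  + apply: (iffLR _ (H _ CKF_T14 (fun=> 0))); sat_axiom.
  + apply: (iffLR _ (H _ CKF_T15 (fun=> 0))); sat_axiom.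
- exact: PAT_sound.
all: move=> e.
- apply: (iffRL _ (true_eq C)); sat_axiom.
- apply: (iffRL _ (true_not C)); sat_axiom.
- apply: (iffRL _ (true_and C)); sat_axiom.
- apply: (iffRL _ (true_all C)); sat_axiom.
- apply: (iffRL _ (inner_eq I)); sat_axiom.
- apply: (iffRL _ (inner_neq I)); sat_axiom.
- apply: (iffRL _ (inner_notnot I)); sat_axiom.
- apply: (iffRL _ (inner_and I)); sat_axiom.
- apply: (iffRL _ (inner_notand I)); sat_axiom.
- apply: (iffRL _ (inner_all I)); sat_axiom.
- apply: (iffRL _ (inner_notall I)); sat_axiom.
- apply: (iffRL _ (inner_T I)); sat_axiom.
- apply: (iffRL _ (inner_F I)); sat_axiom.
- apply: (iffRL _ D); sat_axiom.
- apply: (iffRL _ (true_subst C)); sat_axiom.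
Qed.

(** * Fixed points *)

(** [kleene_clause] computed from the shape of the sentence.  The two clauses
    for [Not (Tr t)] merge into one, because [neg_code] maps non-sentences to
    the negation of [Falsum], which fixed points contain. *)
Definition clause (X : nat -> Prop) (A : form) : Prop :=
  match A with
  | Eq s t => value s = value t
  | Tr t => X (value t)
  | And B C => X (code B) /\ X (code C)
  | All v B => forall t, closed_term t -> X (code (fsubst v t B))
  | Not (Eq s t) => value s <> value t
  | Not (Tr t) => X (neg_code (value t))
  | Not (Not B) => X (code B)
  | Not (And B C) => X (code (Not B)) \/ X (code (Not C))
  | Not (All v B) =>
      exists2 t, closed_term t & X (code (Not (fsubst v t B)))
  end.

Definition solves_clauses (X : nat -> Prop) : Prop :=
  forall A, sentence A -> (X (code A) <-> clause X A).

Lemma kleene_clauseE X A : (forall n, X n -> Sent n) ->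
  X (code (Not Falsum)) -> sentence A -> (kleene_clause X A <-> clause X A).
Proof.
move=> XS X1 sA; split=> [[] //=|].
- move=> t B -> XB; suff sB : sentence B by rewrite neg_code_sentence.
  by have := XS _ XB; rewrite /Sent codeE.
- by move=> t nSt; rewrite neg_code_nonsentence.
- by move=> v B t ct XB; exists t.
case: A sA => [s t|t|[s t|t|B|B C|v B]|B C|v B] sA /= H.
- exact: K_eq.
- exact: K_T.
- exact: K_neq.
- have [/SentP[B sB tB]|nSt] := classic (Sent (value t)).
    by apply: (K_notT tB); rewrite tB neg_code_sentence in H.
  exact: K_notT_nonsent.
- exact: K_notnot.
- exact: K_notand.
- by case: H => t ct; apply: K_notall.
- by case: H; apply: K_and.
- exact: K_all.
Qed.

Lemma fixed_pointE X : (forall n, X n -> Sent n) ->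
  (fixed_point X <-> solves_clauses X).
Proof.
move=> XS; split=> [F | C].
  have F1 A : X (code A) -> kleene_clause X A.
    by case/F=> B [/code_inj <-].
  have X1 : X (code (Not Falsum)).
    by apply/F; exists (Not Falsum); split=> //; apply: K_neq.
  move=> A sA; rewrite -(kleene_clauseE XS X1 sA); split=> [/F1 //|KA].
  by apply/F; exists A.
have X1 : X (code (Not Falsum)) by apply/C.
move=> n; split=> [Xn | [A [-> sA]]].
  have /SentP[A sA En] := XS _ Xn; rewrite {}En in Xn *.
  by exists A; split=> //; apply/(kleene_clauseE XS X1 sA)/C.
by move/(kleene_clauseE XS X1 sA)/C => /(_ sA).
Qed.

(** * Truth of sentences in an expansion of the standard model *)

Fixpoint fsize (A : form) : nat :=
  match A with
  | Eq _ _ | Tr _ => 0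
  | Not B | All _ B => (fsize B).+1
  | And B C => (fsize B + fsize C).+1
  end.

Lemma fsize_fsubst v t A : fsize (fsubst v t A) = fsize A.
Proof.
by elim: A => //= [A ->|A -> B ->|w A IHA] //; case: eqP => //= _; rewrite IHA.
Qed.

(** Size is used because the instances of a quantified formula are smaller than
    it, but are not its subformulas. *)
Lemma sentence_ind (P : form -> Prop) :
    (forall A, sentence A ->
       (forall B, sentence B -> fsize B < fsize A -> P B) -> P A) ->
  forall A, sentence A -> P A.
Proof.
move=> IH A; have [n] := ubnP (fsize A).
elim: n A => // n IHn A An sA; apply: IH => // B sB BA.
by apply: IHn sB; apply: leq_trans BA _.
Qed.

Definition true_in (X : nat -> Prop) (A : form) : Prop := sat X (fun=> 0) A.

(** Only the sentences in [S] are compared with the truths. *)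
Definition is_truth_set (S X : nat -> Prop) : Prop :=
  forall A, sentence A -> (S (code A) <-> true_in X A).

Lemma truth_set_code X A : sentence A -> (truth_set X (code A) <-> true_in X A).
Proof.
move=> sA; split=> [[B [/code_inj <- _ MA]] | TA]; first exact: MA.
by exists A; split=> //; apply/(models_sentence _ (fun=> 0)).
Qed.

Lemma is_truth_setE S X :
  is_truth_set S X <-> forall n, Sent n -> (S n <-> truth_set X n).
Proof.
split=> [T n /SentP[A sA ->] | T A sA]; first by rewrite truth_set_code // T.
by rewrite T ?truth_set_code // /Sent codeE.
Qed.

Lemma true_in_Tr X t : closed_term t -> (true_in X (Tr t) <-> X (value t)).
Proof. by move=> ct; rewrite /true_in /= eval_closed. Qed.

Lemma true_in_Fa X t :
  closed_term t -> (true_in X (Fa t) <-> X (neg_code (value t))).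
Proof. by move=> ct; rewrite /true_in /= eval_closed. Qed.

Lemma true_in_Eq X s t : closed_term s -> closed_term t ->
  (true_in X (Eq s t) <-> value s = value t).
Proof. by move=> cs ct; rewrite /true_in /= !eval_closed. Qed.

Lemma true_in_All X v A : true_in X (All v A) <->
  forall t, closed_term t -> true_in X (fsubst v t A).
Proof. exact: sat_All_closed. Qed.

Lemma internal_code S A :
  sentence A -> (internal S (code A) <-> S (code (Tr (quote A)))).
Proof.
move=> sA; split=> [[B [/code_inj <- _ /(_ (fun=> 0))]] | SA] /=.
  by rewrite eval_quote.
by exists A; split=> // e; rewrite /= eval_quote.
Qed.

Lemma internal_Sent S n : internal S n -> Sent n.
Proof. by case=> A [-> sA _]; rewrite /Sent codeE. Qed.

(** A compositional set is determined by its atomic sentences. *)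
Lemma is_truth_set_compositional (S X : nat -> Prop) : compositional S ->
    (forall t, closed_term t -> (S (code (Tr t)) <-> X (value t))) ->
  is_truth_set S X.
Proof.
move=> C ST; apply: sentence_ind => -[s t|t|A|A B|v A] sA IH.
- have /andP[cs ct] : closed_term s && closed_term t by rewrite -sentence_Eq.
  by rewrite true_in_Eq // true_eq.
- by rewrite true_in_Tr // ST.
- by rewrite true_not // IH.
- have /andP[cA cB] : sentence A && sentence B by rewrite -sentence_And.
  by rewrite true_and // !IH //= ltnS ?leq_addr ?leq_addl.
have fA : form1 v A by rewrite -sentence_All.
rewrite true_in_All true_all //.
have IHt t : closed_term t ->
  S (code (fsubst v t A)) <-> true_in X (fsubst v t A).
  by move=> ct; apply: IH; rewrite ?sentence_fsubst //= fsize_fsubst.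
by split=> H t ct; apply/(IHt t ct)/H.
Qed.

Lemma compositional_truth_set S X : is_truth_set S X -> compositional S.
Proof.
move=> T; split=> [s cs t ct|A sA|A sA B sB|v A fA|v A fA s cs t ct st].
- by rewrite T ?true_in_Eq // sentence_Eq cs.
- by rewrite !T.
- by rewrite !T // sentence_And sA.
- rewrite T ?sentence_All // true_in_All.
  by split=> H t ct; have := H t ct; rewrite T // sentence_fsubst.
by rewrite !T ?sentence_fsubst // /true_in !sat_fsubst_closed // st.
Qed.

(** * Inner truth *)

Section TrueInternal.
Variables (S : nat -> Prop) (C : compositional S).

(** This is [CKF_R1] for the formula T v, a term, and the numeral of its
    value. *)
Lemma true_Tr_value t :
  closed_term t -> (S (code (Tr t)) <-> S (code (Tr (numeral (value t))))).
Proof.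
move=> ct; have f0 : form1 0 (Tr (Var 0)) by [].
by have /= := true_subst C f0 ct (closed_numeral _)
  (esym (value_numeral (value t))).
Qed.

Lemma true_Fa_neg_code t : closed_term t ->
  (S (code (Fa t)) <-> S (code (Tr (numeral (neg_code (value t)))))).
Proof. by move=> ct; rewrite /Fa (true_Tr_value (t := dneg t)). Qed.

Lemma true_Fa_quote A : sentence A ->
  (S (code (Fa (quote A))) <-> S (code (Tr (quote (Not A))))).
Proof.
move=> sA; rewrite true_Fa_neg_code ?closed_numeral //.
by rewrite value_numeral neg_code_sentence.
Qed.

(** If [t] denotes a non-sentence, F t amounts to the truth of the negation of
    [Falsum], so S contains it.  Hence TFTt holds, [disquoting] puts the
    negation of T t into S, and S does not contain T t. *)
Lemma true_Tr_Sent t : inner_clauses S -> disquoting S -> closed_term t ->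
  S (code (Tr t)) -> Sent (value t).
Proof.
move=> I D ct St; apply: NNPP => nSt.
have F1 : S (code (Fa (quote Falsum))) by apply/(inner_neq I).
have /(inner_F I ct) : S (code (Fa t)).
  rewrite true_Fa_neg_code // neg_code_nonsentence //.
  by rewrite true_Fa_quote in F1.
rewrite true_Fa_quote // => /(D _ (closed_numeral _)).
by rewrite value_numeral true_not.
Qed.

Lemma true_Tr_internal t : inner_clauses S -> disquoting S -> closed_term t ->
  (S (code (Tr t)) <-> internal S (value t)).
Proof.
move=> I D ct; split=> [St | It].
  have /SentP[A sA tA] := true_Tr_Sent I D ct St.
  by rewrite tA internal_code // /quote -tA -true_Tr_value.
have /SentP[A sA tA] := internal_Sent It.
by move: It; rewrite true_Tr_value // tA internal_code.
Qed.

End TrueInternal.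

Lemma true_in_inst_numerals X A n v :
  true_in X (inst_numerals A n v) <->
  sat X (upd (upd (fun=> 0) 1 v) 0 n) A.
Proof.
by rewrite /true_in !sat_fsubst_closed ?closed_numeral // !value_numeral.
Qed.

(** Read in (N, X), the sentences under T in [CKF_T12] and [CKF_T13] are the
    Kleene clauses for a quantified sentence and for its negation. *)
Lemma true_in_all_true X A v :
  true_in X (inst_numerals all_true (code A) v) <->
  forall t, closed_term t -> X (code (fsubst v t A)).
Proof.
rewrite true_in_inst_numerals; apply: sat_all_term => t ct.
by rewrite /= /upd /= codeE.
Qed.

Lemma true_in_some_false X A v : form1 v A ->
  (true_in X (inst_numerals some_false (code A) v) <->
   exists2 t, closed_term t & X (code (Not (fsubst v t A)))).
Proof.
move=> fA; rewrite true_in_inst_numerals; apply: sat_ex_term => t ct.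
by rewrite /= /upd /= codeE neg_code_sentence ?sentence_fsubst.
Qed.

Lemma sentence_inst_numerals A n v :
  all (mem [:: 0; 1]) (fv A) -> sentence (inst_numerals A n v).
Proof.
move=> A01; rewrite sentence_fsubst ?closed_numeral // /form1.
rewrite fv_fsubst ?closed_numeral // all_filter.
by apply: sub_all A01 => x; rewrite !inE => /orP[]/eqP->.
Qed.

(** Axiom by axiom, one side of the biconditional is membership in X of a
    sentence of a given shape, and the other is its Kleene clause. *)
Lemma inner_clausesE S (X := internal S) : is_truth_set S X ->
  (inner_clauses S <-> solves_clauses X).
Proof.
move=> T; have C := compositional_truth_set T.
have ST A : sentence A -> (S (code (Tr (quote A))) <-> X (code A)).
  by move=> sA; rewrite /X internal_code.
have SF A : sentence A -> (S (code (Fa (quote A))) <-> X (code (Not A))).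
  by move=> sA; rewrite true_Fa_quote // /X internal_code.
have SI v A : S (code (inst_numerals all_true (code A) v)) <->
    forall t, closed_term t -> X (code (fsubst v t A)).
  by rewrite T ?true_in_all_true // sentence_inst_numerals.
have SE v A : form1 v A -> (S (code (inst_numerals some_false (code A) v)) <->
    exists2 t, closed_term t & X (code (Not (fsubst v t A)))).
  by move=> fA; rewrite T ?true_in_some_false // sentence_inst_numerals.
have EqP s t : sentence (Eq s t) -> closed_term s /\ closed_term t.
  by rewrite sentence_Eq => /andP.
have AndP A B : sentence (And A B) -> sentence A /\ sentence B.
  by rewrite sentence_And => /andP.
split=> [I|F].
  case=> [s t|t|[s t|t|A|A B|v A]|A B|v A] sA /=.
  - by have [cs ct] := EqP _ _ sA; rewrite -ST // inner_eq.
  - by rewrite -ST // inner_T // T // true_in_Tr.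
  - by have [cs ct] := EqP _ _ sA; rewrite -SF // inner_neq.
  - by rewrite -SF // inner_F // T // true_in_Fa.
  - by rewrite -!ST // -inner_notnot.
  - by have [cA cB] := AndP _ _ sA; rewrite -!SF // inner_notand.
  - have fA : form1 v A by rewrite -sentence_All.
    by rewrite -SF // inner_notall // SE.
  - by have [cA cB] := AndP _ _ sA; rewrite -!ST // inner_and.
  - have fA : form1 v A by rewrite -sentence_All.
    by rewrite -ST // inner_all // SI.
split=> [s cs t ct|s cs t ct|A sA|A sA B sB|A sA B sB|v A fA|v A fA|t ct|t ct].
- by have sA : sentence (Eq s t); rewrite ?sentence_Eq ?cs // ST // F.
- by have sA : sentence (Eq s t); rewrite ?sentence_Eq ?cs // SF // F.
- by rewrite !ST // (F (Not (Not A))).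
- have sAB : sentence (And A B) by rewrite sentence_And sA.
  by rewrite !ST // (F (And A B)).
- have sAB : sentence (And A B) by rewrite sentence_And sA.
  by rewrite !SF // (F (Not (And A B))).
- by rewrite -sentence_All in fA; rewrite SI ST // F.
- have sA : sentence (All v A) by rewrite sentence_All.
  by rewrite SE // SF // F.
- by rewrite ST // F // T // true_in_Tr.
- by rewrite SF // F // T // true_in_Fa.
Qed.

Lemma consistent_and X : solves_clauses X -> consistent X ->
  forall A, sentence A -> X (code A) -> ~ X (code (Not A)).
Proof.
move=> F cX A sA XA XnA; apply: cX; exists A.
by apply/F; rewrite // sentence_And sA.
Qed.

(** Induction on size.  Consistency is needed for [Not (Tr t)]: if the value of
    [t] belonged to X, it would be a sentence, and X would also contain its
    negation by the clause for [Not (Tr t)]. *)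
Lemma fixed_point_true X : (forall n, X n -> Sent n) ->
    solves_clauses X -> consistent X ->
  forall A, sentence A -> X (code A) -> true_in X A.
Proof.
move=> XS F cX; apply: sentence_ind => A sA IH; rewrite F //.
case: A sA IH => [s t|t|[s t|t|A|A B|v A]|A B|v A] sA IH /=.
- by move: sA; rewrite sentence_Eq => /andP[cs ct]; rewrite true_in_Eq.
- by rewrite true_in_Tr.
- move: sA; rewrite [sentence _]sentence_Eq => /andP[cs ct] st.
  by move/(true_in_Eq X cs ct).
- move=> Xn /(true_in_Tr X sA) Xt; have /SentP[A cA tA] := XS _ Xt.
  rewrite tA in Xt; apply: (consistent_and F cX cA Xt).
  by rewrite -neg_code_sentence // -tA.
- by move=> XA; apply; apply: (IH A).
- move: sA; rewrite [sentence _]sentence_And => /andP[cA cB].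
  have lA : fsize (Not A) < fsize (Not (And A B)) by rewrite /= !ltnS leq_addr.
  have lB : fsize (Not B) < fsize (Not (And A B)) by rewrite /= !ltnS leq_addl.
  by case=> [/(IH (Not A) cA lA) nA|/(IH (Not B) cB lB) nB] [].
- case=> t ct Xt /true_in_All/(_ t ct); apply: IH Xt => //.
    by rewrite [sentence _]sentence_fsubst // -sentence_All.
  by rewrite /= fsize_fsubst.
- move: sA; rewrite sentence_And => /andP[cA cB] [XA XB].
  by split; apply: IH; rewrite //= ltnS ?leq_addr ?leq_addl.
move=> H; apply/true_in_All => t ct; apply: IH (H t ct).
  by rewrite sentence_fsubst // -sentence_All.
by rewrite /= fsize_fsubst.
Qed.

(** * The characterization of the models *)

Theorem mainTheorem2 (S : nat -> Prop) :
  models_theory S CKFcs <->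
  (consistent_fixed_point (internal S) /\
   forall n : nat, Sent n -> (S n <-> truth_set (internal S) n)).
Proof.
have XS := @internal_Sent S.
rewrite models_CKFcs -is_truth_setE /consistent_fixed_point fixed_pointE //.
split=> [[C I D] | [[F cX] T]].
  have T : is_truth_set S (internal S).
    by apply: is_truth_set_compositional => // t; apply: true_Tr_internal.
  have F := iffLR (inner_clausesE T) I.
  do 2!split=> //; move=> [A XA].
  have sAA : sentence (And A (Not A)).
    by have := XS _ XA; rewrite /Sent codeE.
  have sA : sentence A by move: sAA; rewrite sentence_And => /andP[].
  have XSt B : sentence B -> internal S (code B) -> S (code B).
    move=> sB; rewrite internal_code // => /(D _ (closed_numeral _)).
    by rewrite value_numeral.
  move: XA; rewrite F // => -[/(XSt _ sA) SA /(XSt (Not A) sA)].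
  by rewrite true_not.
split; [exact: compositional_truth_set T | exact/inner_clausesE |].
move=> t ct; rewrite T // true_in_Tr // => Xt.
have /SentP[A sA tA] := XS _ Xt; rewrite tA in Xt *.
by apply/T => //; apply: fixed_point_true.
Qed.
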